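(* Let $n\ge 1$, $\boldsymbol{a}\in\{0,1\}^{n-1}$ and $\vec{\sigma}\in\{0,1\}^n$, and put $L=\sum_{i=1}^{n-1}a_i(1-2\sigma_i)$ and $\ell=\sum_{i=1}^{n}(1-2\sigma_i)$. Then $$\bigl(2^n L_2(\mathcal{P}_{\boldsymbol{a}}(\vec{\sigma}))\bigr)^2=\frac{1}{64}\Bigl((\ell-L)^2+L^2+8\ell-10L+\frac53 n\Bigr)+\frac{1}{2^{n+4}}\bigl(2\sigma_nL-\ell+4\bigr)+\frac38-\frac19\cdot\frac{1}{2^{2n+3}}.$$ Consequently, if for every $n\ge1$ vectors $\boldsymbol{a}^{(n)}\in\{0,1\}^{n-1}$, $\vec{\sigma}^{(n)}\in\{0,1\}^n$ are given, with corresponding quantities $L_n,\ell_n$, then there exists $C>0$ with $L_2(\mathcal{P}_{\boldsymbol{a}^{(n)}}(\vec{\sigma}^{(n)}))\le C\sqrt{\log 2^n}/2^n$ for all $n\ge1$ if and only if there exists $C'>0$ with $|\ell_n-L_n|\le C'\sqrt{n}$ and $|L_n|\le C'\sqrt{n}$ for all $n\ge 1$.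
   Context: $\oplus$ denotes addition modulo 2. For an integer $n\ge1$, $\boldsymbol{a}=(a_1,\dots,a_{n-1})\in\{0,1\}^{n-1}$ and $\vec{\sigma}=(\sigma_1,\dots,\sigma_n)\in\{0,1\}^n$, let $\mathcal{P}_{\boldsymbol{a}}(\vec{\sigma})\subset[0,1)^2$ be the set of the $2^n$ points $\bigl(\frac{t_n}{2}+\frac{t_{n-1}}{4}+\dots+\frac{t_1}{2^n},\ \frac{b_1}{2}+\dots+\frac{b_n}{2^n}\bigr)$, where $(t_1,\dots,t_n)$ ranges over $\{0,1\}^n$, $b_k=t_k\oplus a_kt_n\oplus\sigma_k$ for $1\le k\le n-1$ and $b_n=t_n\oplus\sigma_n$. (This is the digital $(0,n,2)$-net in base 2 generated by the anti-diagonal $n\times n$ matrix and the identity matrix with last column replaced by $(a_1,\dots,a_{n-1},1)^T$, digitally shifted by $\vec\sigma$ in the second coordinate.) For an $N$-point set $\mathcal{P}\subset[0,1)^2$ the discrepancy function is $\Delta(\boldsymbol{t},\mathcal{P})=\frac1N\#\{\boldsymbol{z}\in\mathcal{P}:\boldsymbol{z}\in[0,t_1)\times[0,t_2)\}-t_1t_2$ for $\boldsymbol{t}=(t_1,t_2)\in[0,1]^2$, and $L_2(\mathcal{P})=\bigl(\int_{[0,1]^2}\Delta(\boldsymbol{t},\mathcal{P})^2\,d\boldsymbol{t}\bigr)^{1/2}$. $\log$ is the natural logarithm. *)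

(* Defs.v *)
From mathcomp Require Export all_boot all_order all_algebra finmap.
From mathcomp Require Export all_classical all_reals all_analysis.
Export Order.TTheory GRing.Theory Num.Theory.
Export numFieldNormedType.Exports.

Set Implicit Arguments.
Unset Strict Implicit.
Unset Printing Implicit Defensive.

Local Open Scope classical_set_scope.
Local Open Scope ring_scope.

(* Coordinates of bit vectors are numbered from 1; used only for 1 <= k <= size. *)
Definition bit (v : seq bool) (k : nat) : bool := nth false v k.-1.

(* b_k; boolean exclusive or [(+)] and conjunction [&&] are the operations of
   the field with two elements. *)
Definition net_digit (n : nat) (a : n.-1.-tuple bool) (s t : n.-tuple bool)
    (k : nat) : bool :=
  if (k < n)%N then bit t k (+) (bit a k && bit t n) (+) bit s k
  else bit t n (+) bit s n.

Definition net_point (R : realType) (n : nat) (a : n.-1.-tuple bool)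
    (s t : n.-tuple bool) : R * R :=
  (\sum_(1 <= k < n.+1) (bit t (n.+1 - k))%:R / 2 ^+ k,
   \sum_(1 <= k < n.+1) (net_digit a s t k)%:R / 2 ^+ k).

Definition net (R : realType) (n : nat) (a : n.-1.-tuple bool)
    (s : n.-tuple bool) : {fset R * R} :=
  [fset net_point R a s t | t in {: n.-tuple bool}]%fset.

Definition discrepancy (R : realType) (P : {fset R * R}) (t : R * R) : R :=
  #|` [fset z in P | (0 <= z.1 < t.1) && (0 <= z.2 < t.2)]%fset|%:R / #|` P|%:R
  - t.1 * t.2.

Definition L2_discrepancy (R : realType) (P : {fset R * R}) : R :=
  Num.sqrt
    (\int[(@lebesgue_measure R \x @lebesgue_measure R)%E]_(t in `[0, 1] `*` `[0, 1])
       (discrepancy P t ^+ 2)).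

Definition big_L (R : realType) (n : nat) (a : n.-1.-tuple bool)
    (s : n.-tuple bool) : R :=
  \sum_(1 <= i < n) (bit a i)%:R * (1 - 2 * (bit s i)%:R).

Definition small_l (R : realType) (n : nat) (s : n.-tuple bool) : R :=
  \sum_(1 <= i < n.+1) (1 - 2 * (bit s i)%:R).

(* Main.v *)
(** Fixing the digit [t_n] splits the net into two digitally shifted Hammersley
    nets with [n - 1] digits, with shifts [sigma] and [sigma (+) a]; a Hammersley
    net in turn splits into two copies of the Hammersley net with one digit less.
    Warnock's formula expresses the squared L2 discrepancy through
    [sum (1 - x^2)(1 - y^2)] over points and
    [sum (1 - max(x, x'))(1 - max(y, y'))] over pairs of points.  For a pair from
    different halves, [max(x, x')] depends on one of the two points only, while
    the second coordinates of the other half fill a full grid, so such pairs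
    contribute a sum of polynomials in the coordinates over a single half.  Both
    sums therefore satisfy recursions on the number of digits, which are solved
    in closed form in terms of the sums of the signs [1 - 2 sigma_k]. *)

Require Import Defs.
From mathcomp Require Import measurable_realfun.
From mathcomp Require Import ring lra zify.

Set Implicit Arguments.
Unset Strict Implicit.
Unset Printing Implicit Defensive.

Local Open Scope ring_scope.

(** * Sums over digitally shifted Hammersley nets *)

(** Points of [P0] receive leading digit 0 in the first coordinate and last digit [b] in the second;
    those of [P1] receive 1 and [~~ b]. The two sequences may differ because the halves of the net
    carry different shifts. *)
Definition interleave (q : nat) (b : bool) (P0 P1 : seq (nat * nat)) :=
  [seq (p.1, b + p.2.*2)%N | p <- P0] ++
  [seq (q + p.1, ~~ b + p.2.*2)%N | p <- P1].

(* Coordinates are scaled by [2 ^ size r] to be integers; [r] lists the digits of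
   the shift of the second coordinate from the last one to the first one. *)
Fixpoint hammersley (r : seq bool) : seq (nat * nat) :=
  if r is b :: r' then
    interleave (2 ^ size r') b (hammersley r') (hammersley r')
  else [:: (0, 0)%N].

Section Sums.
Variable R : realFieldType.

Definition bias (r : seq bool) : R := \sum_(b <- r) (1 - 2 * b%:R).

Lemma bias_cons b r : bias (b :: r) = (1 - 2 * b%:R) + bias r.
Proof. by rewrite /bias big_cons. Qed.

Lemma sum_interleave q b P0 P1 (F : nat * nat -> R) :
  \sum_(p <- interleave q b P0 P1) F p =
  \sum_(p <- P0) F (p.1, b + p.2.*2)%N +
  \sum_(p <- P1) F (q + p.1, ~~ b + p.2.*2)%N.
Proof. by rewrite big_cat !big_map. Qed.

Lemma natr_double (b : bool) k : (b + k.*2)%:R = b%:R + 2 * k%:R :> R.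
Proof. by rewrite natrD -mul2n natrM. Qed.

Lemma sum_evens_odds (f : nat -> R) m :
  \sum_(0 <= k < m) f k.*2 + \sum_(0 <= k < m) f k.*2.+1 =
  \sum_(0 <= k < m.*2) f k.
Proof.
elim: m => [|m IH]; first by rewrite !big_geq// addr0.
by rewrite doubleS !big_nat_recr//= -IH; ring.
Qed.

(** The two halves fill the even and the odd numbers below [2 ^ size r]; the digit [b] only decides
    which half is which. *)
Lemma sum_hammersley_snd (f : nat -> R) r :
  \sum_(p <- hammersley r) f p.2 = \sum_(0 <= k < 2 ^ size r) f k.
Proof.
elim: r f => [|b r IH] f; first by rewrite big_seq1 big_nat1.
rewrite sum_interleave/= expnS mul2n.
rewrite (IH (fun k => f (b + k.*2)%N)) (IH (fun k => f (~~ b + k.*2)%N)).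
by rewrite -sum_evens_odds; case: b => //=; rewrite addrC.
Qed.

(** * Moments of the coordinates of a shifted Hammersley net *)

Local Notation card r := (2 ^+ size r : R).

Lemma sum_hammersley1 r : \sum_(p <- hammersley r) (1 : R) = card r.
Proof.
rewrite (sum_hammersley_snd (fun=> 1)) big_const_nat subn0 iter_addr addr0.
by rewrite natrX.
Qed.

(** The free parameter carries the induction: the leading digit of the upper half is absorbed by
    lowering [A] by a power of two. *)
Lemma sum_hammersley_x (A : R) r :
  \sum_(p <- hammersley r) (A - p.1%:R) = card r * (A - (card r - 1) / 2).
Proof.
elim: r A => [|b r IH] A; first by rewrite big_seq1/=; field.
rewrite sum_interleave/=.
under [X in _ + X]eq_bigr => p _ do rewrite natrD opprD addrA.
by rewrite !IH natrX (exprS _ (size r)); field.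
Qed.

Lemma sum_hammersley_x2 (A : R) r :
  \sum_(p <- hammersley r) (A - p.1%:R) ^+ 2 =
  card r * ((A - (card r - 1) / 2) ^+ 2 + (card r ^+ 2 - 1) / 12).
Proof.
elim: r A => [|b r IH] A; first by rewrite big_seq1/=; field.
rewrite sum_interleave/=.
under [X in _ + X]eq_bigr => p _ do rewrite natrD opprD addrA.
by rewrite !IH natrX (exprS _ (size r)); field.
Qed.

(** Absorbs a new last digit of the second coordinate into the parameter [B], so that the induction
    hypothesis applies. *)
Lemma square_double (B : R) (c : bool) (y : nat) :
  (B - (c + y.*2)%:R) ^+ 2 = 4 * ((B - c%:R) / 2 - y%:R) ^+ 2.
Proof. by rewrite natr_double; field. Qed.

Lemma sum_hammersley_y2 (B : R) r :
  \sum_(p <- hammersley r) (B - p.2%:R) ^+ 2 =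
  card r * ((B - (card r - 1) / 2) ^+ 2 + (card r ^+ 2 - 1) / 12).
Proof.
elim: r B => [|b r IH] B; first by rewrite big_seq1/=; field.
rewrite sum_interleave/=.
under eq_bigr => p _ do rewrite square_double.
under [X in _ + X]eq_bigr => p _ do rewrite square_double.
by rewrite -!mulr_sumr !IH (exprS _ (size r)); case: b => /=; field.
Qed.

(** Complementing all digits reflects the net in its centre, so the mixed third central moment
    vanishes. Besides the product term only twice the covariance [card r * bias r / 8] survives,
    multiplied by the centred [B]. *)
Lemma sum_hammersley_xy2 (A B : R) r :
  \sum_(p <- hammersley r) (A - p.1%:R) * (B - p.2%:R) ^+ 2 =
  card r * ((A - (card r - 1) / 2) *
              ((B - (card r - 1) / 2) ^+ 2 + (card r ^+ 2 - 1) / 12)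
            + (B - (card r - 1) / 2) * (card r * bias r) / 4).
Proof.
elim: r A B => [|b r IH] A B; first by rewrite big_seq1/= /bias big_nil; field.
rewrite sum_interleave/=.
under eq_bigr => p _ do rewrite square_double mulrCA.
under [X in _ + X]eq_bigr => p _ do
  rewrite natrD opprD addrA square_double mulrCA.
rewrite -!mulr_sumr !IH natrX (exprS _ (size r)) bias_cons.
by case: b => /=; field.
Qed.

(* For a uniformly chosen point, [v] is the variance of each coordinate and [c]
   their covariance; the last summand is the joint fourth cumulant. *)
Lemma sum_hammersley_x2y2 (A B : R) r :
  let a := A - (card r - 1) / 2 in
  let b := B - (card r - 1) / 2 in
  let v := (card r ^+ 2 - 1) / 12 in
  let c := card r * bias r / 8 in
  \sum_(p <- hammersley r) (A - p.1%:R) ^+ 2 * (B - p.2%:R) ^+ 2 =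
  card r * ((a ^+ 2 + v) * (b ^+ 2 + v) + 4 * a * b * c + 2 * c ^+ 2
            - (size r)%:R * card r ^+ 2 / 32).
Proof.
elim: r A B => [|b r IH] A B; first by rewrite big_seq1/= /bias big_nil; field.
rewrite sum_interleave/=.
under eq_bigr => p _ do rewrite square_double mulrCA.
under [X in _ + X]eq_bigr => p _ do
  rewrite natrD opprD addrA square_double mulrCA.
rewrite -!mulr_sumr !IH/= natrX (exprS _ (size r)) bias_cons -(natr1 (size r)).
by case: b => /=; field.
Qed.

(** * Sums over pairs of points *)

Lemma sum_max_parity (c : bool) (y q : nat) : (y < q)%N ->
  \sum_(0 <= k < q) (maxn (c + y.*2) (~~ c + k.*2))%:R =
  (y%:R + c%:R) ^+ 2 + q%:R * (q%:R - c%:R) :> R.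
Proof.
move=> yq; rewrite (big_cat_nat (n := y))//=; last exact: ltnW.
have -> : \sum_(0 <= k < y) (maxn (c + y.*2) (~~ c + k.*2))%:R =
    \sum_(0 <= k < y) (c + y.*2)%:R :> R.
  by apply: eq_big_nat => k /andP[_ ky]; congr (_%:R); case: c => /=; lia.
have sumd (d : R) m k : \sum_(m <= j < m + k) (d + 2 * j%:R) =
    k%:R * (d + 2 * m%:R + k%:R - 1).
  elim: k => [|k IH]; first by rewrite addn0 big_geq// mul0r.
  by rewrite addnS big_nat_recr ?leq_addr//= IH natrD -(natr1 k); ring.
rewrite big_const_nat subn0 iter_addr addr0 -mulr_natr.
(* The term [k = y] stands alone: its two arguments are 2y and 2y + 1 in some order. Before it the
   first argument is the larger one, after it the second. *)
rewrite big_ltn//.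
have -> : \sum_(y.+1 <= k < q) (maxn (c + y.*2) (~~ c + k.*2))%:R =
    \sum_(y.+1 <= k < q) ((~~ c)%:R + 2 * k%:R) :> R.
  apply: eq_big_nat => k /andP[ky _]; rewrite -natr_double; congr (_%:R).
  by case: c => /=; lia.
have -> : maxn (c + y.*2) (~~ c + y.*2) = y.*2.+1 by case: c => /=; lia.
have [d ->] : exists d, q = (y.+1 + d)%N by exists (q - y.+1)%N; lia.
have -> : y.*2.+1%:R = 1 + 2 * y%:R :> R by rewrite -(natr_double true).
by rewrite sumd natr_double natrD -(natr1 y); case: c => /=; ring.
Qed.

(** For [A = B = N] this is N^2 times Warnock's double sum over the points divided by N. General [A]
    and [B] are kept because the recursion changes them. *)
Definition pair_sum (A B : R) (P : seq (nat * nat)) : R :=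
  \sum_(p <- P) \sum_(p' <- P)
    (A - (maxn p.1 p'.1)%:R) * (B - (maxn p.2 p'.2)%:R).

Lemma interleave_lt q b P0 P1 (p : nat * nat) :
  (forall p : nat * nat, p \in P0 -> (p.1 < q)%N /\ (p.2 < q)%N) ->
  (forall p : nat * nat, p \in P1 -> (p.1 < q)%N /\ (p.2 < q)%N) ->
  p \in interleave q b P0 P1 -> (p.1 < 2 * q)%N /\ (p.2 < 2 * q)%N.
Proof.
move=> lt0 lt1; rewrite mem_cat => /orP[] /mapP[[x y] xy ->] /=;
  [have [/= ? ?] := lt0 _ xy|have [/= ? ?] := lt1 _ xy];
  by case: b; rewrite /=; split; lia.
Qed.

Lemma hammersley_lt r (p : nat * nat) : p \in hammersley r ->
  (p.1 < 2 ^ size r)%N /\ (p.2 < 2 ^ size r)%N.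
Proof.
elim: r p => [|b r IH] p /=; first by rewrite inE => /eqP ->.
by rewrite expnS; exact: interleave_lt.
Qed.

(** A point [p] of the upper half has the larger first coordinate, so [p'] enters only through its
    second coordinate, which runs over a full grid of parity opposite to [c]. The square is written
    with [- c%:R - p.2%:R] to fit the moment sums. *)
Lemma sum_cross (A B : R) (c : bool) r0 r1 : size r0 = size r1 ->
  \sum_(p <- hammersley r1) \sum_(p' <- hammersley r0)
    (A - (maxn (2 ^ size r1 + p.1) p'.1)%:R) *
    (B - (maxn (c + p.2.*2) (~~ c + p'.2.*2))%:R) =
  \sum_(p <- hammersley r1) (A - card r1 - p.1%:R) *
    (card r1 * (B - card r1 + c%:R) - (- c%:R - p.2%:R) ^+ 2).
Proof.
move=> r01; rewrite big_seq [RHS]big_seq.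
apply: eq_bigr => p /hammersley_lt[xq yq].
transitivity (\sum_(p' <- hammersley r0) (A - card r1 - p.1%:R) *
    (B - (maxn (c + p.2.*2) (~~ c + p'.2.*2))%:R)).
  rewrite big_seq [RHS]big_seq; apply: eq_bigr => p' /hammersley_lt[x'q _].
  congr (_ * _); rewrite (maxn_idPl _); last first.
    by rewrite -r01 (leq_trans (ltnW x'q))// leq_addr.
  by rewrite natrD natrX opprD addrA.
rewrite -mulr_sumr; congr (_ * _).
rewrite (sum_hammersley_snd (fun k => B - (maxn (c + p.2.*2) (~~ c + k.*2))%:R)).
rewrite sumrB big_const_nat subn0 iter_addr addr0 r01 sum_max_parity//.
by rewrite -[B *+ _]mulr_natr natrX; ring.
Qed.

(** Pairs within one half give a smaller sum of the same kind, the factor 2 coming from the halved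
    second coordinate; the mixed pairs count twice by symmetry. *)
Lemma pair_sum_interleave (A B : R) (b : bool) r0 r1 : size r0 = size r1 ->
  pair_sum A B (interleave (2 ^ size r1) b (hammersley r0) (hammersley r1)) =
  2 * pair_sum A ((B - b%:R) / 2) (hammersley r0) +
  2 * pair_sum (A - card r1) ((B - (~~ b)%:R) / 2) (hammersley r1) +
  2 * \sum_(p <- hammersley r1) (A - card r1 - p.1%:R) *
        (card r1 * (B - card r1 + (~~ b)%:R) - (- (~~ b)%:R - p.2%:R) ^+ 2).
Proof.
move=> r01; rewrite /pair_sum sum_interleave/=.
have maxD k m n : (maxn (k + m.*2) (k + n.*2) = k + (maxn m n).*2)%N by lia.
under eq_bigr => p _ do rewrite sum_interleave/=.
under [X in _ + X]eq_bigr => p _ do rewrite sum_interleave/=.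
rewrite !big_split/=.
have -> : \sum_(p <- hammersley r0) \sum_(p' <- hammersley r1)
    (A - (maxn p.1 (2 ^ size r1 + p'.1))%:R) *
    (B - (maxn (b + p.2.*2) (~~ b + p'.2.*2))%:R) =
    \sum_(p <- hammersley r1) \sum_(p' <- hammersley r0)
    (A - (maxn (2 ^ size r1 + p.1) p'.1)%:R) *
    (B - (maxn (~~ b + p.2.*2) (b + p'.2.*2))%:R).
  rewrite exchange_big/=; apply: eq_bigr => p _; apply: eq_bigr => p' _.
  by rewrite maxnC [in X in _ * X]maxnC.
have := sum_cross A B (~~ b) r01; rewrite negbK => ->.
have -> : \sum_(p <- hammersley r0) \sum_(p' <- hammersley r0)
    (A - (maxn p.1 p'.1)%:R) * (B - (maxn (b + p.2.*2) (b + p'.2.*2))%:R) =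
    2 * pair_sum A ((B - b%:R) / 2) (hammersley r0).
  rewrite /pair_sum mulr_sumr; apply: eq_bigr => p _.
  rewrite mulr_sumr; apply: eq_bigr => p' _.
  by rewrite maxD natr_double; field.
have -> : \sum_(p <- hammersley r1) \sum_(p' <- hammersley r1)
    (A - (maxn (2 ^ size r1 + p.1) (2 ^ size r1 + p'.1))%:R) *
    (B - (maxn (~~ b + p.2.*2) (~~ b + p'.2.*2))%:R) =
    2 * pair_sum (A - card r1) ((B - (~~ b)%:R) / 2) (hammersley r1).
  rewrite /pair_sum mulr_sumr; apply: eq_bigr => p _.
  rewrite mulr_sumr; apply: eq_bigr => p' _.
  by rewrite maxD -addn_maxr natrD natrX natr_double; field.
by rewrite /pair_sum; ring.
Qed.

Lemma sum_cross_hammersley (A D c : R) r :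
  \sum_(p <- hammersley r) (A - p.1%:R) * (D - (c - p.2%:R) ^+ 2) =
  D * (card r * (A - (card r - 1) / 2)) -
  card r * ((A - (card r - 1) / 2) *
              ((c - (card r - 1) / 2) ^+ 2 + (card r ^+ 2 - 1) / 12)
            + (c - (card r - 1) / 2) * (card r * bias r) / 4).
Proof.
under eq_bigr => p _ do rewrite mulrBr mulrC.
by rewrite sumrB -mulr_sumr sum_hammersley_x sum_hammersley_xy2.
Qed.

(** Each coordinate takes every value below N = [card r] once, so the coefficient of [A + B] is
    minus the sum of max(i, j) over i, j < N. Only the constant term, the sum of the products of
    both maxima, sees the shift. *)
Lemma pair_sum_hammersley (A B : R) r :
  pair_sum A B (hammersley r) =
  A * B * card r ^+ 2
  - (A + B) * (card r * (card r - 1) * (4 * card r + 1) / 6)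
  + (4 / 9 * card r ^+ 4 - 2 / 3 * card r ^+ 3 + card r ^+ 2 / 18
     + card r / 6 + card r ^+ 3 * bias r / 16 + card r ^+ 2 * bias r ^+ 2 / 32
     + card r ^+ 2 * (size r)%:R / 96).
Proof.
elim: r A B => [|b r IH] A B.
  by rewrite /pair_sum !big_seq1/= maxnn /bias big_nil; field.
rewrite [hammersley _]/= pair_sum_interleave// !IH sum_cross_hammersley/=.
rewrite (exprS _ (size r)) bias_cons -(natr1 (size r)).
by case: b => /=; field.
Qed.

(** * Warnock's expression for two joined Hammersley nets *)

Lemma sum_hammersley_compl (A c d : R) r :
  \sum_(p <- hammersley r)
     (A ^+ 2 - (c - p.1%:R) ^+ 2) * (A ^+ 2 - 4 * (d - p.2%:R) ^+ 2) =
  A ^+ 4 * \sum_(p <- hammersley r) 1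
  - A ^+ 2 * \sum_(p <- hammersley r) (c - p.1%:R) ^+ 2
  - 4 * A ^+ 2 * \sum_(p <- hammersley r) (d - p.2%:R) ^+ 2
  + 4 * \sum_(p <- hammersley r) (c - p.1%:R) ^+ 2 * (d - p.2%:R) ^+ 2.
Proof.
rewrite !mulr_sumr -!sumrB -big_split/=; apply: eq_bigr => p _; ring.
Qed.

(** The left side is N^2 times Warnock's expression for the points divided by N. When [r1] arises
    from [r0] by flipping the digits selected by a, exactly the selected signs change, so [L] is the
    sum of the selected signs of [r0]. *)
Lemma warnock_interleave (b : bool) r0 r1 : size r0 = size r1 ->
  let P := interleave (2 ^ size r1) b (hammersley r0) (hammersley r1) in
  let N := 2 * card r1 in
  let l := bias r0 + (1 - 2 * b%:R) in
  let L := (bias r0 - bias r1) / 2 in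
  N ^+ 2 / 9
  - \sum_(p <- P) (N ^+ 2 - p.1%:R ^+ 2) * (N ^+ 2 - p.2%:R ^+ 2)
      / (2 * N ^+ 3)
  + pair_sum N N P / N ^+ 2 =
  1 / 64 * ((l - L) ^+ 2 + L ^+ 2 + 8 * l - 10 * L
            + 5 / 3 * (size r1).+1%:R)
  + 1 / (16 * N) * (2 * b%:R * L - l + 4) + 3 / 8 - 1 / (72 * N ^+ 2).
Proof.
move=> r01 P N l L; rewrite pair_sum_interleave// !pair_sum_hammersley.
rewrite sum_cross_hammersley -mulr_suml sum_interleave/=.
(* Both halves are brought to the shape of the moment sums: a leading digit moves into the first
   parameter, a last digit, halved, into the second. *)
have -> : \sum_(p <- hammersley r0)
    (N ^+ 2 - p.1%:R ^+ 2) * (N ^+ 2 - (b + p.2.*2)%:R ^+ 2) =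
    \sum_(p <- hammersley r0)
     (N ^+ 2 - (0 - p.1%:R) ^+ 2) * (N ^+ 2 - 4 * (- b%:R / 2 - p.2%:R) ^+ 2).
  by apply: eq_bigr => p _; rewrite natr_double; field.
have -> : \sum_(p <- hammersley r1)
    (N ^+ 2 - (2 ^ size r1 + p.1)%:R ^+ 2) *
    (N ^+ 2 - (~~ b + p.2.*2)%:R ^+ 2) =
    \sum_(p <- hammersley r1)
     (N ^+ 2 - (- card r1 - p.1%:R) ^+ 2) *
     (N ^+ 2 - 4 * (- (~~ b)%:R / 2 - p.2%:R) ^+ 2).
  by apply: eq_bigr => p _; rewrite natr_double natrD natrX; field.
rewrite !sum_hammersley_compl !sum_hammersley1.
rewrite !sum_hammersley_x2 !sum_hammersley_y2 !sum_hammersley_x2y2/=.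
rewrite r01 /l /L /N -(natr1 (size r1)).
have : card r1 != 0 by rewrite expf_neq0// pnatr_eq0.
move: (card r1) (size r1)%:R (bias r0) (bias r1) => q m u v q0.
by case: b {P l L} => /=; field.
Qed.
End Sums.

(** * Warnock's formula *)

Local Open Scope classical_set_scope.
Local Open Scope ring_scope.

Lemma Rintegral_lincomb (R : realType) (d : measure_display)
    (T : measurableType d) (mu : {measure set T -> \bar R}) (D : set T)
    (I : Type) (s : seq (R * I)) (F : I -> T -> R) :
  measurable D -> (forall i, mu.-integrable D (EFin \o F i)) ->
  \int[mu]_(t in D) (\sum_(w <- s) w.1 * F w.2 t) =
  \sum_(w <- s) w.1 * \int[mu]_(t in D) F w.2 t.
Proof.
move=> mD iF.
have iw (w : R * I) : mu.-integrable D (EFin \o (fun t => w.1 * F w.2 t)).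
  have := integrableZl mD w.1 (iF w.2).
  by apply: eq_integrable => // t _ /=; rewrite EFinM.
elim: s => [|w s IH].
  rewrite big_nil; under eq_Rintegral do rewrite big_nil.
  by rewrite /Rintegral integral0.
rewrite big_cons -IH -RintegralZl// -RintegralD//.
  by under eq_Rintegral do rewrite big_cons.
have := integrable_sum mD s (P := xpredT) (fun i _ => iw i).
by apply: eq_integrable => // t _ /=; rewrite -sumEFin.
Qed.

Section Warnock.
Variable R : realType.
Local Notation mu := (@lebesgue_measure R).
Local Notation mu2 := (mu \x mu)%E.
Local Notation I01 := `[(0 : R), 1]%classic.

(** The squared discrepancy function is a linear combination of products of two such functions: k =
    0 for pairs of points, k = 1 for the mixed terms, k = 2 for the squared area. *)
Definition step_pow (x : R) (k : nat) (t : R) : R := (x < t)%R%:R * t ^+ k.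

Lemma measurable_step_pow x k : measurable_fun setT (step_pow x k).
Proof.
apply: measurable_funM; last exact: exprn_measurable.
have -> : (fun t : R => (x < t)%R%:R : R) = \1_`]x, +oo[.
  by apply/funext => t; rewrite indicE mem_setE/= in_itv/= andbT.
exact: measurable_indic.
Qed.

Lemma step_pow_ge0 x k t : I01 t -> 0 <= step_pow x k t.
Proof.
by rewrite /= in_itv/= => /andP[t0 _]; rewrite mulr_ge0// exprn_ge0.
Qed.

Lemma integral_step_pow (x : R) k : 0 <= x < 1 ->
  (\int[mu]_(t in I01) (step_pow x k t)%:E)%E =
  ((1 - x ^+ k.+1) / k.+1%:R)%:E.
Proof.
move=> /andP[x0 x1].
have -> : (\int[mu]_(t in I01) (step_pow x k t)%:E)%E =
    (\int[mu]_(t in I01 `&` `]x, +oo[) (t ^+ k)%:E)%E.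
  rewrite integral_mkcondr; apply: eq_integral => t _; rewrite patchE.
  rewrite mem_setE/= in_itv/= andbT /step_pow.
  by case: ifP => _; rewrite ?mul1r ?mul0r.
have -> : I01 `&` `]x, +oo[ = `]x, 1]%classic.
  apply/seteqP; split => t /=; rewrite !in_itv/= ?andbT.
    by case=> /andP[_ ->] ->.
  by move=> /andP[xt ->]; rewrite xt (le_trans x0 (ltW xt)).
rewrite integral_itv_obnd_cbnd; last first.
  by apply/measurable_EFinP/measurable_funTS; exact: exprn_measurable.
rewrite (@continuous_FTC2 _ _ (fun t => t ^+ k.+1 / k.+1%:R))//.
- by rewrite expr1n -EFinB -mulrBl.
- by apply: continuous_in_subspaceT => t _; exact: exprn_continuous.
- split.
  + by move=> t _; apply: derivableM => //; exact: exprn_derivable.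
  + apply: cvg_at_right_filter; apply: cvgM; [exact: exprn_continuous|exact: cvg_cst].
  + apply: cvg_at_left_filter; apply: cvgM; [exact: exprn_continuous|exact: cvg_cst].
- move=> t _; rewrite derive1Mr; last exact: exprn_derivable.
  by rewrite exp_derive1 -pred_Sn mulrAC divff ?mul1r// pnatr_eq0.
Qed.

Lemma integral_prod_ge0 (f g : R -> R) :
  measurable_fun setT f -> measurable_fun setT g ->
  (forall t, I01 t -> 0 <= f t) -> (forall t, I01 t -> 0 <= g t) ->
  (\int[mu2]_(t in I01 `*` I01) (f t.1 * g t.2)%:E =
   (\int[mu]_(t in I01) (f t)%:E) * (\int[mu]_(t in I01) (g t)%:E))%E.
Proof.
move=> mf mg f0 g0.
have mR (h : R -> R) : measurable_fun setT h -> measurable_fun setT (h \_ I01).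
  by move=> mh; apply/(measurable_restrictT _ _).1 => //; exact: measurable_funTS.
have R0 (h : R -> R) : (forall t, I01 t -> 0 <= h t) ->
    forall t, 0 <= (h \_ I01) t.
  by move=> h0 t; rewrite patchE; case: ifPn => // /set_mem/h0.
have RE (h : R -> R) t : ((EFin \o h) \_ I01) t = ((h \_ I01) t)%:E.
  by rewrite !patchE; case: ifP.
(* Extension by zero outside the unit interval turns this into an integral over the whole plane,
   where Tonelli's theorem applies. *)
rewrite integral_mkcond.
transitivity (\int[mu2]_t ((f \_ I01) t.1 * (g \_ I01) t.2)%:E)%E.
  apply: eq_integral => t _; rewrite !patchE in_setX.
  by case: (t.1 \in I01); case: (t.2 \in I01); rewrite ?mul0r ?mulr0.
rewrite fubini_tonelli1//=; last 2 first.
- apply/measurable_EFinP; apply: measurable_funM.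
    by apply: (measurableT_comp (mR _ mf)); exact: measurable_fst.
  by apply: (measurableT_comp (mR _ mg)); exact: measurable_snd.
- by move=> t; rewrite lee_fin mulr_ge0// R0.
rewrite [X in (X * _)%E]integral_mkcond [X in (_ * X)%E]integral_mkcond.
under [X in (X * _)%E]eq_integral do rewrite RE.
under [X in (_ * X)%E]eq_integral do rewrite RE.
rewrite /fubini_F/=.
under eq_integral => x _.
  under eq_integral do rewrite EFinM.
  rewrite ge0_integralZl//; last 3 first.
  - by apply/measurable_EFinP; exact: mR.
  - by move=> t _; rewrite lee_fin R0.
  - by rewrite lee_fin R0.
  over.
rewrite ge0_integralZr//.
- by apply/measurable_EFinP; exact: mR.
- by move=> t _; rewrite lee_fin R0.
- by apply: integral_ge0 => t _; rewrite lee_fin R0.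
Qed.


Definition step_pow2 (w : nat * R * R) (t : R * R) : R :=
  step_pow w.1.2 w.1.1 t.1 * step_pow w.2 w.1.1 t.2.

Lemma step_pow_le1 x k t : I01 t -> step_pow x k t <= 1.
Proof.
rewrite /= in_itv/= => /andP[t0 t1]; rewrite /step_pow.
by case: (x < t); rewrite ?mul0r// mul1r exprn_ile1.
Qed.

Lemma integrable_step_pow2 w :
  mu2.-integrable (I01 `*` I01) (EFin \o step_pow2 w).
Proof.
apply: measurable_bounded_integrable.
- by apply: measurableX.
- rewrite /= product_measure1E//= lebesgue_measure_itv/= lte_fin ltr01.
  by rewrite oppr0 adde0 mule1 ltry.
- apply: measurable_funTS; apply: measurable_funM.
    by apply: (measurableT_comp (measurable_step_pow _ _)); exact: measurable_fst.
  by apply: (measurableT_comp (measurable_step_pow _ _)); exact: measurable_snd.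
- exists 1; split => // M M1 t [t1 t2] /=; apply: le_trans (ltW M1).
  rewrite ger0_norm; last by rewrite mulr_ge0// step_pow_ge0.
  by rewrite mulr_ile1 ?step_pow_ge0 ?step_pow_le1.
Qed.

Lemma Rintegral_step_pow2 k (x y : R) : 0 <= x < 1 -> 0 <= y < 1 ->
  \int[mu2]_(t in I01 `*` I01) step_pow2 (k, x, y) t =
  (1 - x ^+ k.+1) * (1 - y ^+ k.+1) / k.+1%:R ^+ 2.
Proof.
move=> x01 y01; rewrite /Rintegral.
rewrite (integral_prod_ge0 (measurable_step_pow x k) (measurable_step_pow y k));
  [|exact: step_pow_ge0..].
by rewrite !integral_step_pow//= mulrACA -invfM expr2.
Qed.

Lemma Rintegral_sum_step_pow2 (Q : seq (R * (nat * R * R))) :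
  \int[mu2]_(t in I01 `*` I01) (\sum_(w <- Q) w.1 * step_pow2 w.2 t) =
  \sum_(w <- Q) w.1 * \int[mu2]_(t in I01 `*` I01) step_pow2 w.2 t.
Proof.
rewrite Rintegral_lincomb//; first exact: measurableX.
by move=> w; exact: integrable_step_pow2.
Qed.

Lemma warnock (P : seq (R * R)) (c : R) :
  (forall z, z \in P -> 0 <= z.1 < 1 /\ 0 <= z.2 < 1) ->
  \int[mu2]_(t in I01 `*` I01)
    (c * (\sum_(z <- P) ((z.1 < t.1) && (z.2 < t.2))%R%:R) - t.1 * t.2) ^+ 2 =
  c ^+ 2 * (\sum_(z <- P) \sum_(z' <- P)
     (1 - Num.max z.1 z'.1) * (1 - Num.max z.2 z'.2))
  - c / 2 * (\sum_(z <- P) (1 - z.1 ^+ 2) * (1 - z.2 ^+ 2)) + 1 / 9.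
Proof.
move=> P01.
(* The three blocks expand the square. In the first, two points both lie below [t] exactly when
   their coordinatewise maximum does; the last is the squared area, with thresholds 0. *)
pose Q := [seq (c ^+ 2, (0%N, Num.max z.1 z'.1, Num.max z.2 z'.2)) |
             z <- P, z' <- P] ++
          [seq (- 2 * c, (1%N, z.1, z.2)) | z <- P] ++
          [:: (1, (2%N, 0, 0))].
transitivity (\int[mu2]_(t in I01 `*` I01)
    (\sum_(w <- Q) w.1 * step_pow2 w.2 t)).
  apply: eq_Rintegral => -[t u] /set_mem[/= + +].
  rewrite !in_itv/= => /andP[t0 _] /andP[u0 _].
  rewrite /Q !big_cat big_allpairs_dep big_map big_seq1/= /step_pow2/=.
  (* The strict threshold 0 loses nothing: at [v = 0] the square vanishes as well. *)
  have sp (v : R) : 0 <= v -> step_pow 0 2 v = v ^+ 2.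
    rewrite le_eqVlt /step_pow => /orP[/eqP <-|->]; last by rewrite mul1r.
    by rewrite expr0n mulr0.
  rewrite !sp//.
  set S := \sum_(z <- P) _.
  have -> : \sum_(z <- P) \sum_(z' <- P) c ^+ 2 *
      (step_pow (Num.max z.1 z'.1) 0 t * step_pow (Num.max z.2 z'.2) 0 u) =
      c ^+ 2 * (S * S).
    rewrite [S * S]big_distrl mulr_sumr; apply: eq_bigr => z _.
    rewrite [X in _ = _ * X]big_distrr mulr_sumr; apply: eq_bigr => z' _ /=.
    congr (_ * _); rewrite /step_pow !expr0 !mulr1 !gt_max -!natrM !mulnb.
    by rewrite andbACA.
  have -> : \sum_(z <- P) - 2 * c * (step_pow z.1 1 t * step_pow z.2 1 u) =
      - 2 * c * (S * (t * u)).
    rewrite big_distrl mulr_sumr; apply: eq_bigr => z _ /=.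
    by congr (_ * _); rewrite /step_pow !expr1 mulrACA -natrM mulnb.
  by ring.
rewrite Rintegral_sum_step_pow2 /Q !big_cat big_allpairs_dep big_map big_seq1/=.
rewrite Rintegral_step_pow2 ?lexx ?ltr01// addrA.
congr (_ + _ + _).
- rewrite mulr_sumr big_seq [RHS]big_seq; apply: eq_bigr => z zP.
  rewrite mulr_sumr big_seq [RHS]big_seq; apply: eq_bigr => z' z'P.
  have [[? ?] [? ?]] := (P01 _ zP, P01 _ z'P).
  rewrite Rintegral_step_pow2//; first by rewrite !expr1; field.
    by rewrite /Num.max; case: ifP.
  by rewrite /Num.max; case: ifP.
- rewrite mulr_sumr -sumrN big_seq [RHS]big_seq; apply: eq_bigr => z zP.
  have [? ?] := P01 _ zP.
  by rewrite Rintegral_step_pow2//; field.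
- by rewrite !expr0n/=; field.
Qed.
End Warnock.

(** * The net as a union of two shifted Hammersley nets *)

(** Descending indices, since [hammersley] consumes the last digit of the shift first. *)
Fixpoint bits_down (s : nat -> bool) (m : nat) : seq bool :=
  if m is m'.+1 then s m :: bits_down s m' else [::].

Lemma size_bits_down s m : size (bits_down s m) = m.
Proof. by elim: m => //= m ->. Qed.

(** The parity of the second coordinate separates the two halves. *)
Lemma uniq_interleave q b P0 P1 :
  uniq P0 -> uniq P1 -> uniq (interleave q b P0 P1).
Proof.
move=> u0 u1; rewrite cat_uniq !map_inj_uniq ?u0 ?u1/=; last 2 first.
- move=> [x y] [x' y'] [/eqP + /eqP]; rewrite !eqn_add2l.
  by move=> /eqP-> /eqP/double_inj->.
- by move=> [x y] [x' y'] [-> /eqP]; rewrite eqn_add2l => /eqP/double_inj->.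
rewrite andbT; apply/hasPn => p /mapP[p1 _ ->]; apply/mapP => -[p0 _ [_]].
by move/(congr1 odd); rewrite !oddD !odd_double; case: b.
Qed.

Lemma uniq_hammersley r : uniq (hammersley r).
Proof. by elim: r => //= b r IH; exact: uniq_interleave. Qed.

Lemma size_hammersley r : size (hammersley r) = (2 ^ size r)%N.
Proof.
elim: r => //= b r IH.
by rewrite size_cat !size_map IH addnn expnS mul2n.
Qed.

Section Digits.
Variable R : realType.

Lemma bias_bits_down s m :
  bias R (bits_down s m) = \sum_(1 <= k < m.+1) (1 - 2 * (s k)%:R).
Proof.
elim: m => [|m IH]; first by rewrite /bias big_nil big_geq.
rewrite [RHS]big_nat_recr//= -IH.
by rewrite bias_cons addrC.
Qed.

(** The digit with the largest index is the leading one of the first coordinate and the last one of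
    the second; this matches [interleave]. *)
Definition has_digits (s : nat -> bool) (m : nat) (t : nat -> bool)
    (p : nat * nat) :=
  p.1%:R = \sum_(1 <= k < m.+1) (t k)%:R * 2 ^+ k.-1 :> R /\
  p.2%:R / 2 ^+ m = \sum_(1 <= k < m.+1) (t k (+) s k)%:R / 2 ^+ k :> R.

Lemma has_digits_snoc s s' m t e p :
  (forall k, (k <= m)%N -> s' k = s k) ->
  has_digits s m t p ->
  has_digits s' m.+1 (fun k => if k == m.+1 then e else t k)
    (e * 2 ^ m + p.1, (e (+) s' m.+1) + p.2.*2)%N.
Proof.
move=> ss' [px py]; split => /=.
  rewrite big_nat_recr//= eqxx natrD natrM natrX px addrC; congr (_ + _).
  by apply: eq_big_nat => k /andP[_ km]; rewrite (ltn_eqF km).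
rewrite big_nat_recr//= eqxx natr_double mulrDl addrC; congr (_ + _).
rewrite exprS -mulf_div divff ?pnatr_eq0// mul1r py.
apply: eq_big_nat => k /andP[_ km]; rewrite (ltn_eqF km) ss'//.
Qed.

(** The shift of the lower digits may depend on the newest digit of [t]. With [s0 = s1] this is the
    Hammersley recursion; with different shifts it produces the terms a_k t_n of the net. *)
Lemma interleave_digits s0 s1 m b p :
  (forall s q, q \in hammersley (bits_down s m) ->
     exists t, has_digits s m t q) ->
  p \in interleave (2 ^ m) b (hammersley (bits_down s0 m))
                             (hammersley (bits_down s1 m)) ->
  exists t, has_digits (fun k => if k == m.+1 then b else
                                 if t m.+1 then s1 k else s0 k) m.+1 t p.
Proof.
move=> IH; rewrite mem_cat => /orP[] /mapP[q /IH[t tq] ->].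
  exists (fun k => if k == m.+1 then false else t k); rewrite eqxx.
  have := @has_digits_snoc s0 (fun k => if k == m.+1 then b else s0 k)
    m t false q _ tq; rewrite eqxx mul0n add0n; apply => k km.
  by rewrite (ltn_eqF _).
exists (fun k => if k == m.+1 then true else t k); rewrite eqxx.
have := @has_digits_snoc s1 (fun k => if k == m.+1 then b else s1 k)
  m t true q _ tq; rewrite eqxx mul1n addTb; apply => k km.
by rewrite (ltn_eqF _).
Qed.

Lemma hammersley_digits s m p :
  p \in hammersley (bits_down s m) -> exists t, has_digits s m t p.
Proof.
elim: m s p => [|m IH] s p.
  rewrite inE => /eqP ->; exists s.
  by split; rewrite big_geq//= mul0r.
rewrite /= size_bits_down => /(interleave_digits IH)[t [px py]].
exists t; split => //; rewrite py; apply: eq_big_nat => k /andP[_ km].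
by case: eqP => [->|_] //; case: ifP.
Qed.

Definition scaled (n : nat) (p : nat * nat) : R * R :=
  (p.1%:R / 2 ^+ n, p.2%:R / 2 ^+ n).

Lemma scaled_inj n : injective (scaled n).
Proof.
have n0 : (2 ^+ n : R)^-1 != 0 by rewrite invr_eq0 expf_neq0// pnatr_eq0.
move=> [x y] [x' y'] [/(mulIf n0)/eqP + /(mulIf n0)/eqP].
by rewrite !eqr_nat => /eqP -> /eqP ->.
Qed.

Section Net.
Variables (m : nat) (a : m.-tuple bool) (s : m.+1.-tuple bool).

(** For t_n = 0 the lower digits are shifted by sigma, for t_n = 1 by the sum of a and sigma modulo
    2. *)
Definition shift0 := bits_down (bit s) m.
Definition shift1 := bits_down (fun k => bit a k (+) bit s k) m.
Definition net_points : seq (nat * nat) :=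
  interleave (2 ^ m) (bit s m.+1) (hammersley shift0) (hammersley shift1).

Lemma net_points_sub p : p \in net_points -> scaled m.+1 p \in @net R m.+1 a s.
Proof.
move=> /(interleave_digits (fun s q => @hammersley_digits s m q))[t [px py]].
apply/imfsetP; exists [tuple t i.+1 | i < m.+1] => //=.
have bitE k : (0 < k <= m.+1)%N -> bit [tuple t i.+1 | i < m.+1] k = t k.
  case: k => // k km; rewrite /bit -pred_Sn.
  by rewrite (nth_mktuple (fun i : 'I_m.+1 => t i.+1) false (Ordinal km)).
congr pair.
  (* [net_point] lists the digits of the first coordinate from t_n down to t_1, so one of the sums
     is reversed. *)
  rewrite px big_nat_rev/= mulr_suml; apply: eq_big_nat => k /andP[k0 km].
  have -> : (1 + m.+2 - k.+1 = m.+2 - k)%N by lia.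
  rewrite bitE; last by lia.
  rewrite -mulrA; congr (_ * _).
  have -> : m.+1 = ((m.+2 - k).-1 + k)%N by lia.
  rewrite exprD invfM mulrA.
  have -> : (((m.+2 - k).-1 + k).+1 - k).-1 = (m.+2 - k).-1 by lia.
  by rewrite divff ?mul1r// expf_neq0// pnatr_eq0.
rewrite py; apply: eq_big_nat => k /andP[k0 km]; congr (_%:R / _).
rewrite /net_digit !bitE ?leqnn//; last by lia.
have [->|km1] := eqVneq k m.+1; first by rewrite ltnn.
have -> : (k < m.+1)%N by lia.
by case: (t m.+1); rewrite ?andbT ?andbF ?addbF ?addbA.
Qed.

Lemma size_net_points : size net_points = (2 ^ m.+1)%N.
Proof.
rewrite size_cat !size_map !size_hammersley !size_bits_down.
by rewrite addnn expnS mul2n.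
Qed.

(** Equality follows from one inclusion by counting: 2^n distinct points lie in a set of at most 2^n
    elements. *)
Lemma perm_net : perm_eq (@net R m.+1 a s) [seq scaled m.+1 p | p <- net_points].
Proof.
have uZ : uniq [seq scaled m.+1 p | p <- net_points].
  rewrite map_inj_uniq; last exact: scaled_inj.
  by apply: uniq_interleave; exact: uniq_hammersley.
have sub : {subset [seq scaled m.+1 p | p <- net_points] <= @net R m.+1 a s}.
  by move=> z /mapP[p /net_points_sub pn ->].
have [|_ eqs] := uniq_min_size uZ sub.
  rewrite size_map size_net_points.
  apply: leq_trans (leq_imfset_card _ _ _) _.
  by rewrite -cardT card_tuple card_bool.
by rewrite uniq_perm ?fset_uniq.
Qed.

Lemma card_net : #|` @net R m.+1 a s| = (2 ^ m.+1)%N.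
Proof. by rewrite (perm_size perm_net) size_map size_net_points. Qed.

Lemma discrepancy_net t : discrepancy (@net R m.+1 a s) t =
  (2 ^+ m.+1)^-1 * (\sum_(z <- [seq scaled m.+1 p | p <- net_points])
                      ((z.1 < t.1) && (z.2 < t.2))%R%:R) - t.1 * t.2.
Proof.
rewrite /discrepancy card_net natrX mulrC; congr (_ * _ - _).
rewrite card_fset_sum1 natr_sum -big_fset_condE/= big_mkcond/=.
rewrite (perm_big _ perm_net)/= !big_map; apply: eq_bigr => p _.
by rewrite /= !divr_ge0 ?exprn_ge0//=; case: ifP.
Qed.
End Net.

(** * The exact discrepancy of the net *)

Lemma L2_discrepancy_net m (a : m.-tuple bool) (s : m.+1.-tuple bool) :
  let N := 2 ^+ m.+1 : R in
  (N * L2_discrepancy (@net R m.+1 a s)) ^+ 2 =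
  N ^+ 2 / 9
  - \sum_(p <- net_points a s) (N ^+ 2 - p.1%:R ^+ 2) * (N ^+ 2 - p.2%:R ^+ 2)
      / (2 * N ^+ 3)
  + pair_sum N N (net_points a s) / N ^+ 2.
Proof.
move=> N; rewrite exprMn /L2_discrepancy sqr_sqrtr; last first.
  by apply: Rintegral_ge0 => t _; rewrite sqr_ge0.
have N0 : 0 < N by rewrite exprn_gt0.
have Nn0 : N != 0 by rewrite gt_eqF.
under eq_Rintegral do rewrite discrepancy_net -/N.
rewrite warnock; last first.
  move=> z /mapP[p pP ->] /=.
  rewrite !divr_ge0 ?exprn_ge0//= !ltr_pdivrMr// !mul1r -natrX !ltr_nat.
  have [] := interleave_lt _ _ pP; rewrite -?expnS; last by move=> -> ->.
    by move=> q /hammersley_lt; rewrite size_bits_down.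
  by move=> q /hammersley_lt; rewrite size_bits_down.
rewrite !big_map /pair_sum -mulr_suml.
have -> : \sum_(z <- net_points a s)
    \sum_(z' <- [seq scaled m.+1 p | p <- net_points a s])
    (1 - Num.max (scaled m.+1 z).1 z'.1) * (1 - Num.max (scaled m.+1 z).2 z'.2) =
    N ^- 2 * pair_sum N N (net_points a s).
  rewrite /pair_sum mulr_sumr; apply: eq_bigr => p _.
  rewrite mulr_sumr big_map; apply: eq_bigr => p' _.
  by rewrite /= -!maxr_pMl ?invr_ge0 ?ltW// -!natr_max !maxEnat -/N; field.
have -> : \sum_(p <- net_points a s)
    (1 - (scaled m.+1 p).1 ^+ 2) * (1 - (scaled m.+1 p).2 ^+ 2) =
    N ^- 4 * \sum_(p <- net_points a s)
       (N ^+ 2 - p.1%:R ^+ 2) * (N ^+ 2 - p.2%:R ^+ 2).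
  by rewrite mulr_sumr; apply: eq_bigr => p _; rewrite /= -/N; field.
by rewrite -/(pair_sum _ _ _); field.
Qed.

Lemma L2_discrepancy_formula n (a : n.-1.-tuple bool) (s : n.-tuple bool) :
  (1 <= n)%N ->
  (2 ^+ n * L2_discrepancy (net R a s)) ^+ 2 =
       1 / 64 * ((small_l R s - big_L R a s) ^+ 2 + big_L R a s ^+ 2
                 + 8 * small_l R s - 10 * big_L R a s + 5 / 3 * n%:R)
       + 1 / 2 ^+ (n + 4) * (2 * (bit s n)%:R * big_L R a s - small_l R s + 4)
       + 3 / 8 - 1 / 9 * (1 / 2 ^+ (2 * n + 3)).
Proof.
case: n a s => // m a s _; set n := m.+1.
have sz : size (shift0 s) = size (shift1 a s) by rewrite !size_bits_down.
have := warnock_interleave R (bit s n) sz.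
rewrite /= size_bits_down -/(net_points a s) -exprS -/n.
rewrite -L2_discrepancy_net.
have -> : bias R (shift0 s) + (1 - 2 * (bit s n)%:R) = small_l R s.
  by rewrite bias_bits_down [RHS]big_nat_recr.
(* Where a_k = 1 the two signs are opposite and differ by 2 (1 - 2 sigma_k); elsewhere they
   cancel. *)
have -> : (bias R (shift0 s) - bias R (shift1 a s)) / 2 = big_L R a s.
  rewrite !bias_bits_down -sumrB mulr_suml; apply: eq_bigr => k _.
  by case: (bit a k); case: (bit s k) => /=; field.
move=> ->.
have -> : 2 ^+ (n + 4) = 16 * 2 ^+ n :> R by rewrite exprD; ring.
have -> : 2 ^+ (2 * n + 3) = 8 * 2 ^+ n ^+ 2 :> R.
  by rewrite exprD mulnC exprM; ring.
have : 2 ^+ n != 0 :> R by rewrite expf_neq0// pnatr_eq0.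
by move: (2 ^+ n) => N N0; field.
Qed.

(** * Growth of the discrepancy with n *)

Lemma norm_sign_le1 (b : bool) : `|1 - 2 * b%:R| <= 1 :> R.
Proof. by rewrite ler_norml; case: b => /=; lra. Qed.

Lemma norm_small_l_le n (s : n.-tuple bool) : `|small_l R s| <= n%:R.
Proof.
apply: le_trans (ler_norm_sum _ _ _) _.
apply: le_trans (ler_sum _ (fun k _ => norm_sign_le1 _)) _.
by rewrite big_const_nat iter_addr addr0 subn1.
Qed.

Lemma norm_big_L_le n (a : n.-1.-tuple bool) (s : n.-tuple bool) :
  `|big_L R a s| <= n%:R.
Proof.
apply: le_trans (ler_norm_sum _ _ _) _.
apply: (@le_trans _ _ (\sum_(1 <= k < n) 1)).
  apply: ler_sum => k _; rewrite normrM; apply: mulr_ile1 => //.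
    by case: bit; rewrite normr_nat.
  exact: norm_sign_le1.
by rewrite big_const_nat iter_addr addr0 ler_nat leq_subr.
Qed.

(** Apart from the two squares every term of the exact formula is at most linear in n, because |l|
    and |L| are at most n; the constant 3 is generous. *)
Lemma L2_discrepancy_approx n (a : n.-1.-tuple bool) (s : n.-tuple bool) :
  (1 <= n)%N ->
  `|(2 ^+ n * L2_discrepancy (net R a s)) ^+ 2
    - ((small_l R s - big_L R a s) ^+ 2 + big_L R a s ^+ 2) / 64| <= 3 * n%:R.
Proof.
move=> n1; rewrite L2_discrepancy_formula//.
have := norm_small_l_le s; have := norm_big_L_le a s.
move: (small_l R s) (big_L R a s) => l L; rewrite !ler_norml.
move=> /andP[L1 L2] /andP[l1 l2].
have {}n1 : 1 <= n%:R :> R by rewrite ler1n.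
have pow_le k : 0 <= (1 / 2 ^+ k : R) <= 1.
  rewrite divr_ge0 ?exprn_ge0//= ler_pdivrMr ?exprn_gt0// mul1r.
  by rewrite exprn_ege1// ler1n.
have /andP[v0 v1] := pow_le (2 * n + 3)%N.
have /andP[u0 u1] : 0 <= (1 / 2 ^+ (n + 4) : R) <= 1 / 16.
  have /andP[w0 w1] := pow_le n; rewrite exprD invfM mulrA.
  have -> : (2 ^+ 4)^-1 = 1 / 16 :> R by field.
  by apply/andP; split; lra.
move: (1 / 2 ^+ (n + 4)) (1 / 2 ^+ (2 * n + 3)) u0 u1 v0 v1 => u v u0 u1 v0 v1.
set w := 2 * _ * L - l + 4.
(* The three summands contribute at most 2n, n and 4 <= 4n. *)
have /andP[w1 w2] : - (7 * n%:R) <= w <= 7 * n%:R.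
  by rewrite /w; case: bit => /=; apply/andP; split; lra.
have uw1 : - (7 * n%:R / 16) <= u * w by nra.
have uw2 : u * w <= 7 * n%:R / 16 by nra.
by apply/andP; split; lra.
Qed.

Lemma norm_le_sqrt (c x y : R) : 0 <= c -> 0 <= y ->
  (`|x| <= c * Num.sqrt y) = (x ^+ 2 <= c ^+ 2 * y).
Proof.
move=> c0 y0; rewrite -[in RHS](sqr_sqrtr y0) -exprMn -real_normK ?num_real//.
by rewrite ler_pXn2r ?nnegrE ?mulr_ge0 ?sqrtr_ge0.
Qed.

Lemma L2_discrepancy_le n (P : {fset R * R}) (c : R) : 0 <= c ->
  (L2_discrepancy P <= c * Num.sqrt (ln (2 ^+ n)) / 2 ^+ n) =
  ((2 ^+ n * L2_discrepancy P) ^+ 2 <= c ^+ 2 * ln 2 * n%:R).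
Proof.
move=> c0; rewrite ler_pdivlMr ?exprn_gt0// mulrC.
have ln2 : 0 <= ln 2 :> R by rewrite ln_ge0// ler1n.
have -> : ln (2 ^+ n) = ln 2 * n%:R :> R by rewrite lnXn ?mulr_natr.
rewrite -mulrA -norm_le_sqrt ?mulr_ge0// ger0_norm//.
by rewrite mulr_ge0 ?exprn_ge0 ?sqrtr_ge0.
Qed.
End Digits.

Theorem theorem1 (R : realType) :
  (forall (n : nat) (a : n.-1.-tuple bool) (s : n.-tuple bool), (1 <= n)%N ->
     (2 ^+ n * L2_discrepancy (net R a s)) ^+ 2 =
       1 / 64 * ((small_l R s - big_L R a s) ^+ 2 + big_L R a s ^+ 2
                 + 8 * small_l R s - 10 * big_L R a s + 5 / 3 * n%:R)
       + 1 / 2 ^+ (n + 4) * (2 * (bit s n)%:R * big_L R a s - small_l R s + 4)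
       + 3 / 8 - 1 / 9 * (1 / 2 ^+ (2 * n + 3)))
  /\
  (forall (a : forall n : nat, n.-1.-tuple bool)
          (s : forall n : nat, n.-tuple bool),
     (exists2 C : R, 0 < C &
        forall n : nat, (1 <= n)%N ->
          L2_discrepancy (net R (a n) (s n)) <= C * Num.sqrt (ln (2 ^+ n)) / 2 ^+ n)
     <->
     (exists2 C' : R, 0 < C' &
        forall n : nat, (1 <= n)%N ->
          `|small_l R (s n) - big_L R (a n) (s n)| <= C' * Num.sqrt n%:R /\
          `|big_L R (a n) (s n)| <= C' * Num.sqrt n%:R)).
Proof.
split; first by move=> n a s; exact: L2_discrepancy_formula.
move=> a s.
have ln2 : 0 < ln 2 :> R by rewrite ln_gt0// ltr1n.
split=> -[C C0 CP].
(* The bound on the discrepancy gives ((l - L)^2 + L^2) / 64 <= (C^2 ln 2 + 3) n, and each square is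
   at most the sum of both. *)
- have K0 : 0 < 64 * (C ^+ 2 * ln 2 + 3).
    by rewrite mulr_gt0// addr_gt0// mulr_gt0// exprn_gt0.
  exists (Num.sqrt (64 * (C ^+ 2 * ln 2 + 3))); first by rewrite sqrtr_gt0.
  move=> n n1; have := CP n n1; rewrite L2_discrepancy_le ?(ltW C0)//.
  have := L2_discrepancy_approx R (a n) (s n) n1.
  rewrite ler_norml => /andP[+ _]; rewrite !norm_le_sqrt ?sqrtr_ge0//.
  rewrite sqr_sqrtr ?(ltW K0)//.
  move: (small_l R (s n)) (big_L R (a n) (s n)) => l L.
  have := sqr_ge0 (l - L); have := sqr_ge0 L.
  by move=> L0 lL0 e1 e2; split; lra.
(* Both squares are at most C^2 n, so their sum over 64 is at most C^2 n / 32; the error adds 3n,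
   and dividing by ln 2 passes from n to log 2^n. *)
- have K0 : 0 < (C ^+ 2 / 32 + 3) / ln 2.
    by rewrite divr_gt0// addr_gt0// divr_gt0// exprn_gt0.
  exists (Num.sqrt ((C ^+ 2 / 32 + 3) / ln 2)); first by rewrite sqrtr_gt0.
  move=> n n1; have [] := CP n n1; rewrite !norm_le_sqrt ?(ltW C0)//.
  rewrite L2_discrepancy_le ?sqrtr_ge0// sqr_sqrtr ?(ltW K0)//.
  rewrite divfK ?gt_eqF// => e1 e2.
  have := L2_discrepancy_approx R (a n) (s n) n1.
  by rewrite ler_norml => /andP[_ e3]; lra.
Qed.
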